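(* Let $K\ge1$, $\alpha\in(0,1)$, let $\mathcal N\subseteq\mathcal K=\{1,\dots,K\}$ be the set of true null indices and $K_0=|\mathcal N|$. For arbitrary non-negative ($[0,\infty]$-valued) random variables $E'_1,\dots,E'_K$ (with any dependence), the base e-BH procedure $\mathcal G(\alpha)$ applied to $E_1',\dots,E_K'$ satisfies $$\mathbb E\left[\frac{F_{\mathcal G(\alpha)}}{R_{\mathcal G(\alpha)}}\right]=\frac{\alpha}{K}\sum_{k\in\mathcal N}\mathbb E\left[t_\alpha\mathbf 1_{\{E'_k\ge t_\alpha\}}\right]\le\frac{K_0}{K}y_\alpha,$$ where $$y_\alpha=\frac1{K_0}\sum_{k\in\mathcal N}\mathbb E\left[T(\alpha E'_k)\right].$$ In particular, $y_\alpha\le\alpha$ in each of the following cases: (1) $E'_1,\dots,E'_K$ are raw e-values, i.e. $\mathbb E[E'_k]\le1$ for $k\in\mathcal N$; (2) they are boosted e-values $E'_k=\phi_k(E_k)$ obtained from raw e-values $E_1,\dots,E_K$ using increasing functions $\phi_k:[0,\infty]\to[0,\infty]$ (for instance $\phi_k(x)=b_kx$ with $b_k\ge1$) such that $\mathbb E[T(\alpha\phi_k(E_k))]\le\alpha$ for $k\in\mathcal N$.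
   Context: $K/\mathcal K:=\{K/k:k\in\mathcal K\}$. Raw e-values are $[0,\infty]$-valued random variables $E_1,\dots,E_K$ with $\mathbb E[E_k]\le1$ for $k\in\mathcal N$. Base e-BH procedure $\mathcal G(\alpha)$: given $e'_1,\dots,e'_K\in[0,\infty]$ with order statistics $e'_{[1]}\ge\dots\ge e'_{[K]}$, let $k_e^*=\max\{k\in\mathcal K:ke'_{[k]}/K\ge1/\alpha\}$ with $\max\varnothing=0$, and reject the hypotheses with the $k_e^*$ largest values. $R_{\mathcal G(\alpha)}$ is the number of rejections, $F_{\mathcal G(\alpha)}$ the number of rejected indices in $\mathcal N$, and $0/0=0$. $T(x)$ is the largest element of $K/\mathcal K\cup\{0\}$ that is no larger than $x\in[0,\infty]$, i.e. $T(x)=\frac{K}{\lceil K/x\rceil}\mathbf 1_{\{x\ge1\}}$, $T(\infty)=K$. The random threshold $t_\alpha$ is $t_\alpha=\inf\{t\in[0,\infty):tR(t)\ge K/\alpha\}$, where $R(t)=\max(|\{k\in\mathcal K:E'_k\ge t\}|,1)$. If $K_0=0$, $y_\alpha$ is interpreted as $0$. *)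

(* Defs.v *)
From mathcomp Require Import all_boot all_order all_algebra.
From mathcomp Require Import all_classical all_reals all_analysis.
From mathcomp Require Import measurable_realfun.

Set Implicit Arguments.
Unset Strict Implicit.
Unset Printing Implicit Defensive.

Import Order.TTheory GRing.Theory Num.Theory.

Local Open Scope ring_scope.

(* Throughout, the hypotheses 1, ..., K are indexed by 'I_K, the ordinal k
   standing for hypothesis k + 1.  Ratios F / R use 0^-1 = 0, so 0 / 0 = 0. *)

Section EBH.
Variables (R : realType) (K : nat).
Implicit Types (alpha t : R) (e : 'I_K -> \bar R) (N : {set 'I_K}).

Definition ebh_order e : seq 'I_K :=
  sort (fun i j : 'I_K => (e j <= e i)%E) (enum 'I_K).

(* The k-th largest value e_[k], for 1 <= k <= K. *)
Definition order_stat e (k : nat) : \bar R :=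
  nth 0%E [seq e i | i <- ebh_order e] k.-1.

Definition ebh_kstar alpha e : nat :=
  \max_(k < K |
    ((alpha^-1)%:E <= (k.+1%:R / K%:R)%:E * order_stat e k.+1)%E) k.+1.

(* Ties never straddle the cut: if e_[k] = e_[k+1] and k satisfies the
   condition defining ebh_kstar, so does k + 1.  Hence the rejected set does
   not depend on how ebh_order breaks ties. *)
Definition ebh_rejected alpha e : {set 'I_K} :=
  [set:: take (ebh_kstar alpha e) (ebh_order e)]%SET.

Definition ebh_R alpha e : nat := #|ebh_rejected alpha e|.

Definition ebh_F alpha N e : nat := #|(ebh_rejected alpha e :&: N)%SET|.

(* The largest element of {K / k : 1 <= k <= K} U {0} that is at most x,
   for x in [0, +oo]. *)
Definition ebh_T (x : \bar R) : R :=
  \big[Num.max/0]_(k < K | ((K%:R / k.+1%:R)%:E <= x)%E) (K%:R / k.+1%:R).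

Definition ebh_count e t : nat :=
  maxn #|[pred k : 'I_K | (t%:E <= e k)%E]| 1.

(* The set contains K / alpha when 0 < alpha, so that inf is the genuine
   infimum. *)
Definition ebh_threshold alpha e : R :=
  inf [set t : R | 0 <= t /\ K%:R / alpha <= t * (ebh_count e t)%:R]%classic.

End EBH.

Arguments ebh_T {R} K x.

Section RandomVariables.
Context {d : measure_display} {Omega : measurableType d} {R : realType}.
Variables (P : probability Omega R) (K : nat) (N : {set 'I_K}).
Implicit Types E : 'I_K -> Omega -> \bar R.

Definition nonneg_rvs E : Prop :=
  forall k, measurable_fun [set: Omega]%classic (E k) /\
            forall w, (0 <= E k w)%E.

Definition raw_evalues E : Prop :=
  nonneg_rvs E /\ forall k, k \in N -> (\int[P]_w E k w <= 1)%E.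

(* y_alpha; it is 0 when N is empty, since then the sum is empty. *)
Definition ebh_y (alpha : R) E : \bar R :=
  ((#|N|%:R^-1)%:E *
    \sum_(k in N) 'E_P[fun w => ebh_T K (alpha%:E * E k w)])%E.

End RandomVariables.

(* An increasing (in the non-strict sense) function from [0, +oo] to
   [0, +oo]; the values of phi at negative arguments are irrelevant. *)
Definition boosting {R : realType} (phi : \bar R -> \bar R) : Prop :=
  (forall x, 0 <= x -> 0 <= phi x)%E /\
  (forall x y, 0 <= x -> x <= y -> phi x <= phi y)%E.

(* Main.v *)
Require Import Defs.
From mathcomp Require Import all_boot all_order all_algebra.
From mathcomp Require Import all_classical all_reals all_analysis.
From mathcomp Require Import measurable_realfun.

(* Put k = max(k*, 1).  Pathwise, t_alpha = K / (alpha k), and the e-BH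
   procedure rejects exactly the hypotheses whose e-value is at least t_alpha.
   Hence F / R = (alpha / K) * sum_(i in N) t_alpha 1{E'_i >= t_alpha} pathwise.
   Moreover alpha t_alpha = K / k lies in the grid K/{1, ..., K}, so
   E'_i >= t_alpha implies T(alpha E'_i) >= alpha t_alpha, which gives the upper
   bound.  Finally T(x) <= x yields the case of raw e-values. *)

Set Implicit Arguments.
Unset Strict Implicit.
Unset Printing Implicit Defensive.

Import Order.TTheory GRing.Theory Num.Theory.

Local Open Scope ring_scope.

(** * Prefixes of sorted sequences *)

Section SortedPrefix.
Variables (T : Type) (r : rel T) (p : pred T).
Hypotheses (r_trans : transitive r)
  (p_closed : forall x y, r x y -> p y -> p x).

Lemma path_count_closed x s : path r x s -> ~~ p x -> count p s = 0%N.
Proof.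
move=> xs npx; apply/eqP; rewrite eqn0Ngt -has_count -all_predC.
apply: sub_all (order_path_min r_trans xs) => y rxy /=.
by apply: contra npx; exact: p_closed.
Qed.

(** In a sorted sequence nothing after a failure of [p] satisfies [p], so the entries satisfying [p]
    form a prefix. *)
Lemma sorted_filter_take s : sorted r s -> seq.filter p s = take (count p s) s.
Proof.
elim: s => [//|x s IH] /= xs; have /IH IHs := path_sorted xs.
case: ifP => [px|/negbT npx]; first by rewrite add1n /= -IHs.
by rewrite IHs (path_count_closed xs npx) take0.
Qed.

Lemma sorted_nth_closed x0 s k :
  sorted r s -> (k < size s)%N -> p (nth x0 s k) = (k < count p s)%N.
Proof.
elim: s k => [//|x s IH] [|k] /= xs; case: (boolP (p x)) => [px|npx].
- by [].
- by rewrite (path_count_closed xs npx).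
- by rewrite ltnS => ks; rewrite (IH _ (path_sorted xs)).
- by rewrite ltnS => ks; rewrite (IH _ (path_sorted xs))//
    (path_count_closed xs npx).
Qed.

End SortedPrefix.

(** * Pathwise analysis of the cut, the threshold and the rejected set *)

Section Pathwise.
Variables (R : realType) (K : nat).
Implicit Types (alpha : R) (e : 'I_K -> \bar R) (N : {set 'I_K}) (x : \bar R).

Definition evalues_above e x : {set 'I_K} := [set i | (x <= e i)%E]%SET.

(** For K, m >= 1, the least value of e_[m] that passes the e-BH test m e_[m] / K >= 1 / alpha. *)
Definition ebh_level alpha (m : nat) : R := K%:R / alpha / m%:R.

(** The maximum with 1 matches the one in [ebh_count] and avoids a division by 0 when nothing is
    rejected. *)
Definition ebh_cut alpha e : nat := maxn (ebh_kstar alpha e) 1.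

Lemma ebh_order_sorted e :
  sorted (fun i j : 'I_K => (e j <= e i)%E) (ebh_order e).
Proof. by apply: sort_sorted => i j; exact: le_total. Qed.

Lemma ebh_order_trans e : transitive (fun i j : 'I_K => (e j <= e i)%E).
Proof. by move=> j i k ji kj; exact: le_trans kj ji. Qed.

Lemma size_ebh_order e : size (ebh_order e) = K.
Proof. by rewrite size_sort size_enum_ord. Qed.

Lemma count_ebh_order e x :
  count (fun i => (x <= e i)%E) (ebh_order e) = #|evalues_above e x|.
Proof.
rewrite /ebh_order (permP (permEl (perm_sort _ _))) -sum1_count -sum1_card.
by rewrite big_enum_cond; apply: eq_bigl => i; rewrite !inE.
Qed.

(** The values at least [x] come first in decreasing order, so sorting reduces to counting.
    Positions [k] start at 0, whereas [order_stat] starts at 1. *)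
Lemma order_stat_ge e x (k : nat) :
  (k < K)%N -> (x <= order_stat e k.+1)%E = (k < #|evalues_above e x|)%N.
Proof.
move=> kK; rewrite /order_stat /=.
rewrite (nth_map (Ordinal kK)) ?size_ebh_order// -count_ebh_order.
apply: (sorted_nth_closed (p := fun i => (x <= e i)%E) (@ebh_order_trans e)).
- by move=> i j /= ji xj; exact: le_trans ji.
- exact: ebh_order_sorted.
- by rewrite size_ebh_order.
Qed.

Lemma take_ebh_order e x :
  [set:: take #|evalues_above e x| (ebh_order e)]%SET = evalues_above e x.
Proof.
rewrite -count_ebh_order.
rewrite -(sorted_filter_take (@ebh_order_trans e) _ (ebh_order_sorted e)).
  by apply/setP => i; rewrite !inE mem_filter mem_sort mem_enum andbT.
by move=> i j /= ji xj; exact: le_trans ji.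
Qed.

Lemma evalues_above_sub e x y :
  (x <= y)%E -> evalues_above e y \subset evalues_above e x.
Proof.
by move=> xy; apply/fintype.subsetP => i; rewrite !inE; exact: le_trans.
Qed.

Lemma card_evalues_above_le e x : (#|evalues_above e x| <= K)%N.
Proof. by rewrite -[leqRHS]card_ord max_card. Qed.

(** Counting form of k*, by [order_stat_ge]; maximality, attainment and measurability all rest on
    it. *)
Lemma ebh_kstarE alpha e : 0 < alpha -> ebh_kstar alpha e =
  (\max_(k < K | (k < #|evalues_above e (ebh_level alpha k.+1)%:E|)%N) k.+1)%N.
Proof.
move=> alpha0; apply: eq_bigl => k; rewrite -order_stat_ge//.
have K0 : 0 < K%:R :> R by rewrite ltr0n (leq_ltn_trans _ (ltn_ord k)).
rewrite -lee_pdivrMl ?divr_gt0// -EFinM; congr (_%:E <= _)%E.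
by rewrite /ebh_level invf_div mulrAC.
Qed.

Lemma ebh_level_le alpha (m n : nat) : 0 < alpha -> (0 < m)%N -> (m <= n)%N ->
  ebh_level alpha n <= ebh_level alpha m.
Proof.
move=> alpha0 m0 mn; rewrite /ebh_level.
rewrite ler_wpM2l ?divr_ge0 ?ler0n ?(ltW alpha0)//.
by rewrite lef_pV2 ?posrE ?ltr0n ?ler_nat// (leq_trans m0).
Qed.

Lemma leq_ebh_kstar alpha e (m : nat) : 0 < alpha -> (0 < m)%N ->
  (m <= #|evalues_above e (ebh_level alpha m)%:E|)%N ->
  (m <= ebh_kstar alpha e)%N.
Proof.
move=> alpha0; case: m => // m _ mA.
(* At most K values reach any level, so this index lies in the range of the maximum. *)
have mK : (m < K)%N by exact: leq_trans mA (card_evalues_above_le _ _).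
rewrite ebh_kstarE//.
exact: (@leq_bigmax_cond _ _ (fun k : 'I_K => k.+1) (Ordinal mK)).
Qed.

Lemma ebh_kstar_leq_card alpha e : 0 < alpha ->
  (ebh_kstar alpha e <=
    #|evalues_above e (ebh_level alpha (ebh_kstar alpha e))%:E|)%N.
Proof.
move=> alpha0; rewrite {2}ebh_kstarE// {1}ebh_kstarE//.
(* The bound holds at the default 0 and at each admissible index, and a maximum of two numbers is
   one of them. *)
by elim/big_ind: _ => // m n; rewrite /maxn; case: ifP.
Qed.

(* For k = max(k*, 1), the level K / (alpha k) is reached by exactly k*
   e-values: if it were reached by n > k*, then n would satisfy the condition
   defining k*.  So this level is both the rejection cut and t_alpha. *)
Lemma card_evalues_above_cut alpha e : 0 < alpha ->
  #|evalues_above e (ebh_level alpha (ebh_cut alpha e))%:E| = ebh_kstar alpha e.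
Proof.
move=> alpha0; set A := evalues_above _ _; apply/eqP.
rewrite eqn_leq; apply/andP; split.
  rewrite leqNgt; apply/negP => kA.
  suff : (#|A| <= ebh_kstar alpha e)%N by rewrite leqNgt kA.
  apply: leq_ebh_kstar => //; first exact: leq_ltn_trans kA.
  apply/subset_leq_card/evalues_above_sub; rewrite lee_fin.
  apply: ebh_level_le; rewrite // /ebh_cut ?leq_max ?orbT// geq_max (ltnW kA).
  exact: leq_ltn_trans kA.
have [->//|k0] := posnP (ebh_kstar alpha e).
by rewrite /A /ebh_cut (maxn_idPl k0) ebh_kstar_leq_card.
Qed.

Lemma ebh_countE e (t : R) :
  ebh_count e t = maxn #|evalues_above e t%:E| 1.
Proof. by rewrite /ebh_count cardsE. Qed.

(** This level lies in the set defining the infimum, and it bounds that set from below because k* is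
    maximal. *)
Lemma ebh_thresholdE alpha e : 0 < alpha ->
  ebh_threshold alpha e = ebh_level alpha (ebh_cut alpha e).
Proof.
move=> alpha0; set c := ebh_cut alpha e.
have c0 : (0 < c)%N by rewrite leq_max orbT.
(* The count at this level, raised to at least 1, is the cut itself, so the product is exactly K /
   alpha. *)
have Sc : [set t : R | 0 <= t /\ K%:R / alpha <= t * (ebh_count e t)%:R]%classic
    (ebh_level alpha c).
  split; first by rewrite !divr_ge0 ?ler0n ?(ltW alpha0).
  by rewrite ebh_countE card_evalues_above_cut// divfK// pnatr_eq0 -lt0n.
apply/eqP; rewrite eq_le; apply/andP; split.
  by apply: ge_inf => //; exists 0 => t [].
apply: lb_le_inf; first by eexists; exact: Sc.
move=> t [t0]; rewrite ebh_countE; set m := maxn _ _ => mt.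
have m0 : (0 < m)%N by rewrite leq_max orbT.
have level_t : ebh_level alpha m <= t by rewrite ler_pdivrMr ?ltr0n.
apply: le_trans (level_t); apply: ebh_level_le => //.
(* If at most one e-value reaches [t], then [m] is 1; otherwise the [m] values reaching [t] also
   reach the level of [m], so [m] is at most k*. *)
rewrite leq_max; case: (leqP #|evalues_above e t%:E| 1) => A1.
  by rewrite {2}/m (maxn_idPr A1) leqnn orbT.
rewrite leq_ebh_kstar//.
apply: leq_trans (subset_leq_card (evalues_above_sub _ _)).
  by rewrite /m (maxn_idPl (ltnW A1)).
exact: level_t.
Qed.

(** Exactly k* e-values reach the threshold, so they are the first k* in decreasing order, however
    ties are broken. *)
Lemma ebh_rejectedE alpha e : 0 < alpha ->
  ebh_rejected alpha e = evalues_above e (ebh_threshold alpha e)%:E.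
Proof.
move=> alpha0; rewrite ebh_thresholdE// /ebh_rejected.
by rewrite -(card_evalues_above_cut e alpha0) take_ebh_order.
Qed.

Lemma ebh_RE alpha e : 0 < alpha -> ebh_R alpha e = ebh_kstar alpha e.
Proof.
move=> alpha0.
by rewrite /ebh_R ebh_rejectedE// ebh_thresholdE// card_evalues_above_cut.
Qed.

Lemma ebh_threshold_ge0 alpha e : 0 < alpha -> 0 <= ebh_threshold alpha e.
Proof.
by move=> a0; rewrite ebh_thresholdE// !divr_ge0 ?ler0n ?(ltW a0).
Qed.

(* If nothing is rejected, every indicator on the right vanishes, in agreement
   with 0 / 0 = 0; otherwise the threshold is [K / (alpha * ebh_R)]. *)
Lemma ebh_fdpE alpha N e : 0 < alpha ->
  (ebh_F alpha N e)%:R / (ebh_R alpha e)%:R =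
  alpha / K%:R * (\sum_(k in N) (ebh_threshold alpha e *
    ((ebh_threshold alpha e)%:E <= e k)%E%:R)) :> R.
Proof.
move=> alpha0; rewrite -big_distrr /=.
have -> : (\sum_(k in N) ((ebh_threshold alpha e)%:E <= e k)%E%:R : R) =
    (ebh_F alpha N e)%:R.
  rewrite -natr_sum -big_mkcondr sum1_card /ebh_F ebh_rejectedE//; congr _%:R.
  by apply: eq_card => k; rewrite !inE andbC.
have [R0|R0] := posnP (ebh_R alpha e).
  have -> : ebh_F alpha N e = 0%N.
    by apply/eqP; rewrite -leqn0 -R0 subset_leq_card// subsetIl.
  by rewrite mul0r !mulr0.
have K0 : K%:R != 0 :> R.
  by rewrite pnatr_eq0 -lt0n (leq_trans R0)// /ebh_R ebh_rejectedE//
    card_evalues_above_le.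
rewrite mulrA mulrC; congr (_ * _).
rewrite ebh_thresholdE// /ebh_level /ebh_cut -ebh_RE// (maxn_idPl R0).
by rewrite !mulrA mulfVK// divff ?gt_eqF// mul1r.
Qed.

Lemma ebh_T_ge0 x : 0 <= ebh_T K x :> R.
Proof. exact: bigmax_ge_id. Qed.

Lemma ebh_T_le x : (0 <= x)%E -> ((ebh_T K x)%:E <= x)%E.
Proof.
move=> x0; rewrite /ebh_T; elim/big_ind: _ => // a b ax bx.
by rewrite EFin_max ge_max ax.
Qed.

Lemma ebh_T_ge x (k : nat) : (0 < k <= K)%N -> ((K%:R / k%:R)%:E <= x)%E ->
  K%:R / k%:R <= ebh_T K x :> R.
Proof.
case: k => // k /= kK kx.
exact: (@le_bigmax_cond _ _ _ _ (Ordinal kK) _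
  (fun k : 'I_K => K%:R / k.+1%:R)).
Qed.

Lemma ebh_threshold_le_T alpha e k : 0 < alpha ->
  alpha * (ebh_threshold alpha e * ((ebh_threshold alpha e)%:E <= e k)%E%:R)
    <= ebh_T K (alpha%:E * e k)%E.
Proof.
move=> alpha0; case: (boolP (_ <= _)%E) => [tk|_]; last first.
  by rewrite !mulr0 ebh_T_ge0.
have tE : alpha * ebh_threshold alpha e = K%:R / (ebh_cut alpha e)%:R.
  rewrite ebh_thresholdE// /ebh_level mulrA [alpha * _]mulrC divfK//.
  by rewrite gt_eqF.
rewrite mulr1 tE; apply: ebh_T_ge.
  (* The cut is at most K: k* is the size of a set of indices, and 1 <= K because [k] inhabits
     ['I_K]. *)
  rewrite /ebh_cut leq_max orbT geq_max /= -ebh_RE// /ebh_R ebh_rejectedE//.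
  by rewrite card_evalues_above_le (leq_ltn_trans _ (ltn_ord k)).
by rewrite -tE EFinM lee_pmul2l// lte_fin.
Qed.

End Pathwise.

(** * Measurability of functions of finitely many events *)

Section Measurability.
Context {d : measure_display} {Omega : measurableType d} {R : realType}.

(** The random set of indices whose event occurs has finitely many values, so a preimage under [g]
    is a finite union of atoms. *)
Lemma measurable_fun_events d' (U : measurableType d') (I : finType)
    (A : Omega -> pred I) (g : {set I} -> U) :
  (forall i, measurable [set w | A w i]%classic) ->
  measurable_fun [set: Omega]%classic (fun w => g [set i | A w i]%SET).
Proof.
move=> mA _ B _; rewrite setTI.
(* The event that the random set equals [S], written so that closure under finite unions and
   complements suffices. *)
pose atom (S : {set I}) : set Omega := (~` \bigcup_(i in [set: I])
  (if i \in S then ~` [set w | A w i] else [set w | A w i]))%classic.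
have atomP w S : atom S w <-> [set i | A w i]%SET = S.
  split=> [Sw|<- [i _]]; last by rewrite inE; case: ifP => //= /negbT/negP.
  apply/setP => i; rewrite inE; apply/idP/idP => [Aw|iS]; apply: contrapT => n.
    by apply: Sw; exists i => //; rewrite (negbTE (introN idP n)).
  by apply: Sw; exists i => //; rewrite iS.
have -> : ((fun w => g [set i | A w i]%SET) @^-1` B =
    \bigcup_(S in [set S | B (g S)]) atom S)%classic.
  apply/seteqP; split => w /=.
    by move=> Bw; exists [set i | A w i]%SET => //; exact/atomP.
  by case=> S /= BS /atomP ->.
apply: fin_bigcup_measurable => // S _; apply: measurableC.
apply: fin_bigcup_measurable => // i _.
by case: ifP => _ //; exact: measurableC.
Qed.

Variables (K : nat) (alpha : R).
Hypothesis alpha0 : 0 < alpha.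
Implicit Types E : 'I_K -> Omega -> \bar R.

(** T(X) is determined by which grid points K / k are at most X. *)
Lemma measurable_ebh_T (X : Omega -> \bar R) :
  measurable_fun [set: Omega]%classic X ->
  measurable_fun [set: Omega]%classic (fun w => ebh_T K (X w)).
Proof.
move=> mX.
pose g (S : {set 'I_K}) : R := \big[Num.max/0]_(k in S) (K%:R / k.+1%:R).
have -> : (fun w => ebh_T K (X w)) =
    (fun w => g [set k : 'I_K | ((K%:R / k.+1%:R)%:E <= X w)%E]%SET).
  by apply/funext => w; apply: eq_bigl => k; rewrite inE.
apply: measurable_fun_events => k.
by rewrite -[X in measurable X]setTI; exact: emeasurable_fun_c_infty.
Qed.

(** The threshold depends on [w] only through the K^2 comparisons of the e-values with the levels of
    1, ..., K. *)
Lemma measurable_ebh_threshold E :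
  (forall k, measurable_fun [set: Omega]%classic (E k)) ->
  measurable_fun [set: Omega]%classic
    (fun w => ebh_threshold alpha (fun k => E k w)).
Proof.
move=> mE.
pose kstar (S : {set 'I_K * 'I_K}) :=
  (\max_(k < K | (k < #|[set i | (i, k) \in S]%SET|)%N) k.+1)%N.
pose A w (ik : 'I_K * 'I_K) := ((ebh_level K alpha ik.2.+1)%:E <= E ik.1 w)%E.
have -> : (fun w => ebh_threshold alpha (fun k => E k w)) =
    (fun w => ebh_level K alpha (maxn (kstar [set ik | A w ik]%SET) 1)).
  apply/funext => w; rewrite ebh_thresholdE// /ebh_cut ebh_kstarE//.
  congr (ebh_level _ _ (maxn _ _)); apply: eq_bigl => k; congr (_ < _)%N.
  by apply: eq_card => i; rewrite !inE.
apply: (@measurable_fun_events _ _ _ A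
  (fun S => ebh_level K alpha (maxn (kstar S) 1))) => ik.
by rewrite -[X in measurable X]setTI; exact: emeasurable_fun_c_infty.
Qed.

Lemma measurable_ebh_summand E (k : 'I_K) :
  (forall k, measurable_fun [set: Omega]%classic (E k)) ->
  measurable_fun [set: Omega]%classic (fun w =>
    ebh_threshold alpha (fun k => E k w) *
    ((ebh_threshold alpha (fun k => E k w))%:E <= E k w)%E%:R : R).
Proof.
move=> mE; apply: measurable_funM; first exact: measurable_ebh_threshold.
rewrite (_ : (fun w => _) = \1_[set w |
  ((ebh_threshold alpha (fun k => E k w))%:E <= E k w)%E]%classic); last first.
  by apply/funext => w; rewrite indicE mem_setE.
apply: measurable_indic; rewrite -[X in measurable X]setTI.
apply: measurable_lee => //.
by apply/measurable_EFinP; exact: measurable_ebh_threshold.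
Qed.

End Measurability.

(** * Expectations and bounds on [ebh_y] *)

Section Expectation.
Context {d : measure_display} {Omega : measurableType d} {R : realType}.
Variables (P : probability Omega R) (K : nat) (N : {set 'I_K}) (alpha : R).
Hypothesis alpha0 : 0 < alpha.
Implicit Types E : 'I_K -> Omega -> \bar R.

(** Nonnegativity takes the place of integrability. *)
Lemma ge0_expectationZl (X : Omega -> R) (c : R) : 0 <= c ->
  measurable_fun [set: Omega]%classic X -> (forall w, 0 <= X w) ->
  ('E_P[fun w => (c * X w)%R] = c%:E * 'E_P[X])%E.
Proof.
move=> c0 mX X0; rewrite unlock.
under eq_integral do rewrite EFinM.
rewrite ge0_integralZl_EFin//; first by move=> w _; rewrite lee_fin.
exact/measurable_EFinP.
Qed.

Lemma ge0_expectation_sum (I : finType) (A : {set I}) (X : I -> Omega -> R) :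
  (forall i, measurable_fun [set: Omega]%classic (X i)) ->
  (forall i w, 0 <= X i w) ->
  ('E_P[fun w => (\sum_(i in A) X i w)%R] = \sum_(i in A) 'E_P[X i])%E.
Proof.
move=> mX X0; rewrite unlock.
under eq_integral do rewrite -sumEFin.
under eq_integral do rewrite -big_enum.
rewrite ge0_integral_sum//; first by rewrite big_enum.
- by move=> i; exact/measurable_EFinP.
- by move=> i w _; rewrite lee_fin.
Qed.

(** Clears the denominator; for empty [N] both sides are 0. *)
Lemma ebh_yZ (E : 'I_K -> Omega -> \bar R) :
  (#|N|%:R%:E * ebh_y P N alpha E =
    \sum_(k in N) 'E_P[fun w => ebh_T K (alpha%:E * E k w)])%E.
Proof.
rewrite /ebh_y; have [/eqP|N0] := eqVneq #|N| 0%N.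
  by rewrite cards_eq0 => /eqP->; rewrite big_set0 !mule0.
by rewrite muleA -EFinM divff ?mul1e// pnatr_eq0.
Qed.

(** An average of terms at most [alpha] is at most [alpha]; for empty [N] the bound reads 0 <=
    [alpha]. *)
Lemma ebh_y_le (E : 'I_K -> Omega -> \bar R) :
  (forall k, k \in N ->
    'E_P[fun w => ebh_T K (alpha%:E * E k w)%E] <= alpha%:E)%E ->
  (ebh_y P N alpha E <= alpha%:E)%E.
Proof.
move=> ET; rewrite /ebh_y.
have [/eqP|N0] := eqVneq #|N| 0%N.
  by rewrite cards_eq0 => /eqP->; rewrite big_set0 mule0 lee_fin ltW.
rewrite lee_pdivrMl ?ltr0n ?lt0n//.
apply: le_trans (lee_sum _ ET) _.
by rewrite sumEFin sumr_const -EFinM lee_fin mulr_natl.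
Qed.

Lemma raw_evalue_expectation_T (X : Omega -> \bar R) :
  measurable_fun [set: Omega]%classic X -> (forall w, (0 <= X w)%E) ->
  (\int[P]_w X w <= 1)%E ->
  ('E_P[fun w => ebh_T K (alpha%:E * X w)%E] <= alpha%:E)%E.
Proof.
move=> mX X0 X1; rewrite unlock.
have maX : measurable_fun [set: Omega]%classic (fun w => (alpha%:E * X w)%E).
  exact: measurable_funeM.
apply: (@le_trans _ _ (\int[P]_w (alpha%:E * X w))%E).
  apply: ge0_le_integral => //.
  - by move=> w _; rewrite lee_fin ebh_T_ge0.
  - by apply/measurable_EFinP; exact: measurable_ebh_T.
  - by move=> w _; rewrite ebh_T_le// mule_ge0// lee_fin ltW.
rewrite ge0_integralZl_EFin ?(ltW alpha0)//.
by rewrite -[leRHS]mule1 lee_wpmul2l// lee_fin ltW.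
Qed.

End Expectation.

Theorem theorem3 (R : realType) (d : measure_display)
    (Omega : measurableType d) (P : probability Omega R)
    (K : nat) (alpha : R) (N : {set 'I_K}) (E' : 'I_K -> Omega -> \bar R)
    (K_ge1 : (1 <= K)%N) (alpha01 : 0 < alpha < 1) (rvE' : nonneg_rvs E') :
  let e w := fun k => E' k w in
  let t w := ebh_threshold alpha (e w) in
  [/\ ('E_P[fun w => ((ebh_F alpha N (e w))%:R / (ebh_R alpha (e w))%:R)%R] =
        (alpha / K%:R)%:E *
        \sum_(k in N) 'E_P[fun w => (t w * ((t w)%:E <= E' k w)%E%:R)%R])%E,
      ((alpha / K%:R)%:E *
        \sum_(k in N) 'E_P[fun w => (t w * ((t w)%:E <= E' k w)%E%:R)%R] <=
        (#|N|%:R / K%:R)%:E * ebh_y P N alpha E')%E,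
      raw_evalues P N E' -> (ebh_y P N alpha E' <= alpha%:E)%E,
      (forall (E : 'I_K -> Omega -> \bar R) (phi : 'I_K -> \bar R -> \bar R),
        raw_evalues P N E ->
        (forall k, boosting (phi k)) ->
        (forall k w, E' k w = phi k (E k w)) ->
        (forall k, k \in N ->
          'E_P[fun w => ebh_T K (alpha%:E * phi k (E k w))%E] <= alpha%:E)%E ->
        (ebh_y P N alpha E' <= alpha%:E)%E) &
      (forall b : R, 1 <= b -> boosting (fun x : \bar R => b%:E * x)%E)].
Proof.
move=> e t; have /andP[alpha0 _] := alpha01.
have mE k : measurable_fun [set: Omega]%classic (E' k) by case: (rvE' k).
have E0 k w : (0 <= E' k w)%E by case: (rvE' k).
have t1_ge0 k w : 0 <= t w * ((t w)%:E <= E' k w)%E%:R :> R.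
  by rewrite mulr_ge0 ?ler0n// ebh_threshold_ge0.
have mt1 k : measurable_fun [set: Omega]%classic
    (fun w => t w * ((t w)%:E <= E' k w)%E%:R : R).
  exact: measurable_ebh_summand.
have aK0 : 0 <= alpha / K%:R by rewrite divr_ge0 ?ler0n// ltW.
split.
(* The pathwise identity [ebh_fdpE] passes to expectations by linearity for nonnegative
   variables. *)
- rewrite -(ge0_expectation_sum P N mt1)// -ge0_expectationZl//.
  + by congr ('E_P[_])%E; apply/funext => w; exact: ebh_fdpE.
  + under eq_fun do rewrite -big_enum.
    exact: measurable_sum.
  + by move=> w; exact: sumr_ge0.
(* The factor 1 / K comes out on both sides and [#|N|] cancels against the average, leaving a
   termwise comparison. *)
- rewrite [#|N|%:R / _]mulrC [alpha / _]mulrC !EFinM -!muleA ebh_yZ.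
  rewrite lee_wpmul2l ?lee_fin ?invr_ge0 ?ler0n//.
  rewrite ge0_sume_distrr; last by move=> k _; exact: expectation_ge0.
  apply: lee_sum => k _; rewrite -ge0_expectationZl ?(ltW alpha0)//.
  apply: expectation_le.
  + exact: measurable_funM.
  + by apply: measurable_ebh_T; exact: measurable_funeM.
  + by move=> w; rewrite mulr_ge0// ltW.
  + by move=> w; exact: ebh_T_ge0.
  + by apply: aeW => w; exact: (ebh_threshold_le_T (e w)).
- case=> _ E1; apply: ebh_y_le => // k kN.
  by apply: raw_evalue_expectation_T => //; exact: E1.
- move=> E phi _ _ Ephi ET; apply: ebh_y_le => // k kN.
  rewrite (_ : E' k = fun w => phi k (E k w)) ?ET//.
  by apply/funext => w; rewrite Ephi.
- move=> b b1; have b0 : 0 <= b := le_trans ler01 b1.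
  by split=> [x x0|x y x0 xy]; [rewrite mule_ge0|rewrite lee_wpmul2l].
Qed.
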